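(* Let $M$ be an abelian group, $I$ a set and $G=M^I$. The following conditions are equivalent: (i) every countable controllable subgroup of $G$ is uniformly controllable in $G$; (ii) every controllable subgroup of $G$ is uniformly controllable in $G$; (iii) either $I$ is finite or $M$ is finitely generated.
   Context: $M^I$ is the direct product $\prod_{i\in I}G_i$ with $G_i=M$ for all $i\in I$. For a family of groups $\{G_i:i\in I\}$ with direct product $G=\prod_{i\in I}G_i$ and $K\subseteq I$, $\bigoplus_{i\in K}G_i$ denotes the subgroup of $G$ consisting of all $g\in G$ such that $g(i)$ is the identity of $G_i$ for all but finitely many $i\in I$ and for every $i\in I\setminus K$. For $J\subseteq I$, $p_{IJ}:\prod_{i\in I}G_i\to\prod_{j\in J}G_j$ is the projection $g\mapsto g\restriction_J$. A subgroup $H$ of $G$ is: controllable in $G$ if $p_{IJ}(H)=p_{IJ}(H\cap\bigoplus_{i\in I}G_i)$ for every finite set $J\subseteq I$; uniformly controllable in $G$ if for every finite set $J\subseteq I$ there exists a finite set $K\subseteq I$ such that $p_{IJ}(H)=p_{IJ}(H\cap\bigoplus_{i\in K}G_i)$. *)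

(* Defs.v *)
From mathcomp Require Import all_boot all_algebra all_classical.

Set Implicit Arguments.
Unset Strict Implicit.
Unset Printing Implicit Defensive.

Import GRing.Theory.

Local Open Scope classical_set_scope.
Local Open Scope ring_scope.

(* Abelian groups are written additively; the power M^I is the function
   type I -> M with its pointwise group structure. *)

Definition subgroup (V : zmodType) (H : set V) : Prop := zmod_closed (mem H).

Definition subgroup_generated (V : zmodType) (A : set V) : set V :=
  smallest (@subgroup V) A.

Definition finitely_generated (V : zmodType) : Prop :=
  exists2 A : set V, finite_set A & subgroup_generated A = [set: V].

Definition direct_sum (I : Type) (M : zmodType) (K : set I) : set (I -> M) :=
  [set g | finite_set [set i | g i <> 0] /\ forall i, ~ K i -> g i = 0].
Arguments direct_sum {I M} K _.

Definition projection (I : Type) (M : zmodType) (J : set I)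
  (H : set (I -> M)) : set (J -> M) := sigL J @` H.
Arguments projection {I M} J H _.

Definition controllable (I : Type) (M : zmodType) (H : set (I -> M)) : Prop :=
  forall J : set I, finite_set J ->
    projection J H = projection J (H `&` direct_sum [set: I]).

Definition uniformly_controllable (I : Type) (M : zmodType)
  (H : set (I -> M)) : Prop :=
  forall J : set I, finite_set J ->
    exists2 K : set I, finite_set K &
      projection J H = projection J (H `&` direct_sum K).

(* Main.v *)
Require Import Defs.
From mathcomp Require Import all_boot all_algebra all_classical.

(** If [I] is finite, [K = I] always witnesses uniform controllability.

    If [M] is finitely generated and [J] is finite, the power [J -> M] is again
    finitely generated, and since [int] is Noetherian so is each of its
    subgroups, in particular [projection J H]
    ([finitely_generated_power], [subgroup_of_generated_seq]).  Controllability
    lifts each of the finitely many generators to an element of [H] of finite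
    support; the union [K] of these supports serves all of [projection J H] at
    once ([finitely_generated_uniformly_controllable]).

    Conversely, let [I] be infinite and [M] not finitely generated.  Choose
    distinct indices [e 0, e 1, ...] and elements [a 0, a 1, ...] of [M], none
    of them generated by its predecessors.  Let [H] be the countable subgroup
    generated by the elements [doubled n], with value [a n] at both [e 0] and
    [e n.+1] and zero elsewhere.  All elements of [H] have finite support, so
    [H] is controllable.  But the term [a n *~ c] that [doubled n *~ c]
    contributes at [e 0] is visible at [e n.+1], where nothing can cancel it.
    Thus if an element of [H] vanishes at [e n.+1] for every [n >= N], its value
    at [e 0] is generated by [a 0, ..., a N.-1] and differs from [a N]; as the
    values at [e 0] include every [a N], no finite [K] works for [J = {e 0}]
    ([not_uniformly_controllable_range_doubled_sum]). *)

Local Open Scope classical_set_scope.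
Local Open Scope ring_scope.

Import GRing.Theory Num.Theory.

(** * Subgroups as sets *)

Lemma subgroupP (V : zmodType) (H : set V) :
  subgroup H <-> H 0 /\ forall x y, H x -> H y -> H (x - y).
Proof.
split=> -[H0 HB]; split; first by rewrite -in_setE; exact: H0.
- by move=> x y Hx Hy; rewrite -in_setE; apply: HB; rewrite in_setE.
- by apply: mem_set.
- by move=> x y /set_mem Hx /set_mem Hy; apply/mem_set/HB.
Qed.

Section SubgroupTheory.
Context {V : zmodType} {H : set V} (sH : subgroup H).

Lemma subgroup0 : H 0.
Proof. by have /subgroupP[] := sH. Qed.

Lemma subgroupB x y : H x -> H y -> H (x - y).
Proof. by have /subgroupP[_] := sH; apply. Qed.

Lemma subgroupD x y : H x -> H y -> H (x + y).
Proof.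
move=> Hx Hy; rewrite -[y]opprK; apply: subgroupB => //.
by rewrite -sub0r; apply: subgroupB => //; apply: subgroup0.
Qed.

Lemma subgroupMz x (k : int) : H x -> H (x *~ k).
Proof.
move=> Hx; have HMn n : H (x *+ n).
  elim: n => [|n IHn]; first exact: subgroup0.
  by rewrite mulrS; apply: subgroupD.
case: k => n; first exact: HMn.
by rewrite NegzE mulrNz -sub0r; apply: subgroupB; [apply: subgroup0|apply: HMn].
Qed.

Lemma subgroup_sum (T : Type) (r : seq T) (P : pred T) (F : T -> V) :
  (forall i, P i -> H (F i)) -> H (\sum_(i <- r | P i) F i).
Proof.
move=> HF; elim/big_ind: _ => //; first exact: subgroup0.
exact: subgroupD.
Qed.

End SubgroupTheory.

Lemma subgroupI (V : zmodType) (A B : set V) :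
  subgroup A -> subgroup B -> subgroup (A `&` B).
Proof.
move=> sA sB; apply/subgroupP; split.
  by split; [exact: (subgroup0 sA)|exact: (subgroup0 sB)].
move=> x y [Ax Bx] [Ay By].
by split; [exact: (subgroupB sA)|exact: (subgroupB sB)].
Qed.

Lemma subgroup_image (U V : zmodType) (f : U -> V) (H : set U) :
  {morph f : x y / x - y} -> subgroup H -> subgroup (f @` H).
Proof.
move=> fB sH; apply/subgroupP; split.
  exists 0; first exact: (subgroup0 sH).
  by rewrite -[0 in LHS](subrr 0) fB subrr.
move=> _ _ [x Hx <-] [y Hy <-]; exists (x - y) => //.
exact: (subgroupB sH).
Qed.

Lemma subgroup_preimage (U V : zmodType) (f : U -> V) (H : set V) :
  {morph f : x y / x - y} -> subgroup H -> subgroup (f @^-1` H).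
Proof.
move=> fB sH; apply/subgroupP; split=> [|x y Hx Hy] /=.
  by rewrite -[0](subrr 0) fB subrr; exact: (subgroup0 sH).
by rewrite fB; exact: (subgroupB sH).
Qed.

Lemma subgroup_subgroup_generated (V : zmodType) (A : set V) :
  subgroup (subgroup_generated A).
Proof.
apply/subgroupP; split=> [B [sB _]|x y Ax Ay B sAB].
  exact: (subgroup0 sB).
by apply: (subgroupB sAB.1); [exact: Ax|exact: Ay].
Qed.

Lemma subgroup_direct_sum (M : zmodType) (I : Type) (K : set I) :
  subgroup (direct_sum (M := M) K).
Proof.
apply/subgroupP; split; first by split=> //; apply: (sub_finite_set _ (finite_set0 I)) => i; apply.
move=> g h [fg g0] [fh h0]; split; last first.
  by move=> i Ki; rewrite -[LHS]/(g i - h i) g0// h0// subrr.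
apply: (@sub_finite_set _ _ ([set i | g i <> 0] `|` [set i | h i <> 0])).
  move=> i /= ghi; apply: contrapT => /not_orP[/contrapT gi /contrapT hi].
  by apply: ghi; rewrite -[LHS]/(g i - h i) gi hi subrr.
by rewrite finite_setU.
Qed.

(** * Subgroups of finitely generated abelian groups *)

(** The generator is the least positive element, or zero if there is none. *)
Lemma int_subgroup_principal (D : set int) : subgroup D ->
  exists2 d, D d & forall k, D k -> (d %| k)%Z.
Proof.
move=> sD.
have DN k : D k -> D (- k).
  by move=> Dk; rewrite -sub0r; apply: (subgroupB sD) => //; apply: (subgroup0 sD).
have [[n Dn]|noD] := pselect (exists n : nat, D n.+1%:Z); last first.
  exists 0; first exact: (subgroup0 sD).
  move=> k Dk; rewrite dvd0z; apply/negPn/negP => k0; apply: noD.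
  exists `|k|%N.-1; rewrite prednK ?absz_gt0//.
  by rewrite abszE; case: (ger0P k) => // _; exact: DN.
have exD : exists n : nat, `[< D n.+1%:Z >] by exists n; apply/asboolP.
case: (ex_minnP exD) => m /asboolP Dm m_min.
exists m.+1%:Z => // k Dk; apply/dvdz_mod0P.
have Dr : D (k %% m.+1%:Z)%Z.
  rewrite /modz mulrC -mulrzz.
  apply: (subgroupB sD) => //; exact: (subgroupMz sD).
have := modz_ge0 k (isT : m.+1%:Z != 0).
have := @ltz_pmod k m.+1%:Z isT.
case: (k %% m.+1%:Z)%Z Dr => // -[//|r] Dr rm _.
have /m_min : `[< D r.+1%:Z >] by apply/asboolP.
by rewrite leqNgt; move: rm; rewrite ltz_nat ltnS => ->.
Qed.

Lemma subr_mulrzB (V : zmodType) (x u w : V) (k l : int) :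
  u - w - x *~ (k - l) = (u - x *~ k) - (w - x *~ l).
Proof.
by rewrite mulrzBr !opprB addrACA [in RHS]addrACA [- w - _]addrC.
Qed.

Lemma subgroup_generated_cons (V : zmodType) (x : V) (s : seq V) (v : V) :
  subgroup_generated [set` x :: s] v ->
  exists k : int, subgroup_generated [set` s] (v - x *~ k).
Proof.
have sG := @subgroup_subgroup_generated _ [set` s].
apply: (smallest_sub (X := [set u | exists k : int,
  subgroup_generated [set` s] (u - x *~ k)])).
  apply/subgroupP; split.
    by exists 0; rewrite subr0; exact: (subgroup0 sG).
  move=> u w [k Gu] [l Gw]; exists (k - l).
  by rewrite subr_mulrzB; exact: (subgroupB sG).
move=> u /=; rewrite inE => /predU1P[->|su].
  by exists 1; rewrite subrr; exact: (subgroup0 sG).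
by exists 0; rewrite subr0; exact: sub_gen_smallest.
Qed.

(** The Noetherian property of finitely generated abelian groups, by induction
    on the number of generators: the coefficients of [x] in the elements of [H]
    form a principal subgroup of [int], so an element [h0] of [H] whose
    coefficient generates it, together with generators of the part of [H] that
    does not involve [x], generates [H]. *)
Lemma subgroup_of_generated_seq (V : zmodType) (s : seq V) (H : set V) :
  subgroup H -> H `<=` subgroup_generated [set` s] ->
  exists2 t : seq V, [set` t] `<=` H & H `<=` subgroup_generated [set` t].
Proof.
elim: s H => [|x s IHs] H sH Hs; first by exists [::].
have sG := @subgroup_subgroup_generated _ [set` s].
have [t tHs Hst] : exists2 t : seq V,
    [set` t] `<=` H `&` subgroup_generated [set` s] &
    H `&` subgroup_generated [set` s] `<=` subgroup_generated [set` t].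
  by apply: IHs; [exact: subgroupI|exact: subIsetr].
pose D := [set k : int |
  exists2 h, H h & subgroup_generated [set` s] (h - x *~ k)].
have sD : subgroup D.
  apply/subgroupP; split.
    by exists 0; rewrite ?subr0; [exact: (subgroup0 sH)|exact: (subgroup0 sG)].
  move=> k l [g Hg Gg] [h Hh Gh]; exists (g - h); first exact: (subgroupB sH).
  by rewrite subr_mulrzB; exact: (subgroupB sG).
have [d [h0 Hh0 Gh0] dD] := int_subgroup_principal _ sD.
exists (h0 :: t).
  by move=> u /=; rewrite inE => /predU1P[->//|/tHs[]].
move=> h Hh.
have [k Gk] := subgroup_generated_cons _ _ _ _ (Hs _ Hh).
have /dvdzP[q kq] : (d %| k)%Z by apply: dD; exists h.
have sG' := @subgroup_subgroup_generated _ [set` h0 :: t].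
rewrite -[h](subrK (h0 *~ q)); apply: (subgroupD sG'); last first.
  by apply: (subgroupMz sG'); apply: sub_gen_smallest; rewrite /= inE eqxx.
have : subgroup_generated [set` t] (h - h0 *~ q).
  apply: Hst; split; first by apply: (subgroupB sH) => //; exact: (subgroupMz sH).
  have -> : h - h0 *~ q = (h - x *~ k) - (h0 - x *~ d) *~ q.
    by rewrite mulrzBl -mulrzA -[(d * q)]mulrC -kq opprB addrA subrK.
  by apply: (subgroupB sG) => //; exact: (subgroupMz sG).
apply: smallest_sub => // u tu; apply: sub_gen_smallest.
by rewrite /= inE; apply/orP; right.
Qed.

Lemma finitely_generatedP (V : zmodType) :
  finitely_generated V <-> exists s : seq V, subgroup_generated [set` s] = setT.
Proof.
split=> [[A /finite_seqP[s ->]]|[s sT]]; first by exists s.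
by exists [set` s].
Qed.

(** The generators are the functions [delta j a] supported at one index [j], for
    [a] ranging over generators of [M]. *)
Lemma finitely_generated_power (M : zmodType) (J : Type) :
  finite_set [set: J] -> finitely_generated M -> finitely_generated (J -> M).
Proof.
move=> fJ /finitely_generatedP[s sT].
pose delta (j : J) (a : M) : J -> M := fun i => if `[< i = j >] then a else 0.
pose A := \bigcup_(j in [set: J]) (delta j @` [set` s]).
exists A.
  apply: bigcup_finite => // j _; apply: finite_image; exact: finite_seq.
rewrite -subTset => g _.
have sG := @subgroup_subgroup_generated _ A.
have deltaG j a : subgroup_generated A (delta j a).
  have : [set: M] a by [].
  rewrite -sT; apply: (smallest_sub (X := delta j @^-1` subgroup_generated A)).
    apply: subgroup_preimage => // x y; apply/funext => i.
    rewrite -[RHS]/(delta j x i - delta j y i) /delta.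
    by case: asboolP => // _; rewrite subrr.
  by move=> x sx; apply: sub_gen_smallest; exists j => //; exists x.
(* An arbitrary type becomes an eqType through [classic], so that it can index
   a sum over an enumeration of its elements. *)
have /finite_seqP[r rT] : finite_set [set: {classic J}] by exact: fJ.
have -> : g = \sum_(j <- undup r) delta j (g j).
  apply/funext => i; rewrite fct_sumE.
  rewrite (bigD1_seq (i : {classic J})) ?undup_uniq//=; last first.
    rewrite mem_undup; have : [set: {classic J}] i by [].
    by rewrite rT.
  rewrite /delta asboolT// big1 ?addr0// => j /eqP ji.
  by rewrite asboolF// => ij; apply: ji.
by apply: (subgroup_sum sG) => j _.
Qed.

(** * Controllability over a finitely generated group *)

Lemma sigLB (I : Type) (M : zmodType) (J : set I) :
  {morph (sigL J : (I -> M) -> (J -> M)) : g h / g - h}.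
Proof. by []. Qed.

(** The elements of [projection J H] that lift to [H `&` direct_sum K] form a
    subgroup, so finitely many lifts suffice. *)
Lemma finitely_generated_uniformly_controllable (M : zmodType) (I : Type) :
  finitely_generated M -> forall H : set (I -> M), subgroup H ->
  controllable H -> uniformly_controllable H.
Proof.
move=> fgM H sH cH J fJ.
have fJT : finite_set [set: J] by rewrite (eq_finite_set (card_setT J)).
have /finitely_generatedP[s sT] := finitely_generated_power M J fJT fgM.
have sp X : subgroup X -> subgroup (projection J X).
  by apply: subgroup_image; exact: sigLB.
have [t tH Ht] : exists2 t : seq (J -> M), [set` t] `<=` projection J H &
    projection J H `<=` subgroup_generated [set` t].
  by apply: (@subgroup_of_generated_seq _ s); [exact: sp|rewrite sT].
have /choice[lift liftP] : forall b : J -> M, exists h : I -> M, b \in t ->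
    (H `&` direct_sum [set: I]) h /\ sigL J h = b.
  move=> b; have [/tH|] := boolP (b \in t); last by exists 0.
  by rewrite cH// => -[h Hh <-]; exists h.
exists (\bigcup_(b in [set` t]) [set i | lift b i <> 0]).
  apply: bigcup_finite; first exact: finite_seq.
  by move=> b /= /liftP[[_ []]].
apply/seteqP; split=> [p Hp|_ [h [Hh _] <-]]; last by exists h.
have := Ht _ Hp; apply: smallest_sub.
  by apply/sp/subgroupI => //; exact: subgroup_direct_sum.
move=> b tb; have [[Hl [fl _]] lb] := liftP b tb.
exists (lift b) => //; split=> //; split=> // i Ki.
by apply: contrapT => li; apply: Ki; exists b.
Qed.

(** * A countable controllable subgroup that is not uniformly controllable *)

Lemma infinite_setT_injection (I : Type) :
  ~ finite_set [set: I] -> exists e : nat -> I, injective e.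
Proof.
move=> /infiniteP/card_leP[f].
exists (fun n => set_val (f (SigSub (mem_setT n)))) => m n /val_inj.
by move=> /(@inj _ _ _ f); rewrite !in_setE => /(_ Logic.I Logic.I) [].
Qed.

(** Each term is chosen outside the proper subgroup generated by the earlier
    ones; [L n] lists the first [n] terms, the latest one first. *)
Lemma escaping_sequence (M : zmodType) : ~ finitely_generated M ->
  exists a : nat -> M, forall n,
    ~ subgroup_generated [set a m | m in `I_n] (a n).
Proof.
move=> nfg.
have /choice[x xP] : forall s : seq M, exists x, ~ subgroup_generated [set` s] x.
  move=> s; apply/existsNP => sT; apply: nfg; apply/finitely_generatedP.
  by exists s; apply/seteqP; split.
pose L n := iter n (fun s => x s :: s) [::].
exists (x \o L) => n; suff -> : [set (x \o L) m | m in `I_n] = [set` L n] by exact: xP.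
elim: n => [|n IHn]; first by apply/seteqP; split=> [_ [//]|].
rewrite IIS image_setU IHn image_set1; apply/seteqP; split=> [u [Lu|->]|u] /=.
- by rewrite inE Lu orbT.
- by rewrite inE eqxx.
- by rewrite inE => /predU1P[->|]; [right|left].
Qed.

Section Counterexample.
Context (M : zmodType) (I : Type) (a : nat -> M) (e : nat -> I).
Context (e_inj : injective e).

Definition doubled n : I -> M :=
  fun i => if `[< i = e 0 \/ i = e n.+1 >] then a n else 0.

(** Integer polynomials serve as finitely supported sequences of coefficients:
    they form a countable group, which makes the range of this map a countable
    subgroup. *)
Definition doubled_sum (p : {poly int}) : I -> M :=
  \sum_(n < size p) doubled n *~ p`_n.

Lemma mulrz_fctE (g : I -> M) (k : int) i : (g *~ k) i = g i *~ k.
Proof.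
have E n : (g *+ n) i = g i *+ n by elim: n => // n IHn; rewrite !mulrS -IHn.
by case: k => n; [exact: E|exact: (congr1 -%R (E n.+1))].
Qed.

Lemma doubled_sum_widen (p : {poly int}) N : (size p <= N)%N ->
  doubled_sum p = \sum_(n < N) doubled n *~ p`_n.
Proof.
move=> pN; rewrite /doubled_sum (big_ord_widen _ (fun n => doubled n *~ p`_n) pN).
rewrite big_mkcond; apply: eq_bigr => n _; case: ltnP => // pn.
by rewrite nth_default.
Qed.

Lemma doubled_sumB : {morph doubled_sum : p q / p - q}.
Proof.
move=> p q; have := size_polyD p (- q); rewrite size_polyN; set N := maxn _ _ => pqN.
rewrite (doubled_sum_widen _ _ pqN) (doubled_sum_widen p N) ?leq_maxl//.
rewrite (doubled_sum_widen q N) ?leq_maxr// -sumrB.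
by apply: eq_bigr => n _; rewrite coefB mulrzBr.
Qed.

Lemma doubled_sum_root p : doubled_sum p (e 0) = \sum_(n < size p) a n *~ p`_n.
Proof.
rewrite /doubled_sum fct_sumE; apply: eq_bigr => n _.
by rewrite mulrz_fctE /doubled asboolT//; left.
Qed.

(** Injectivity of [e] leaves only [doubled n] to contribute at [e n.+1]: this
    is where an element of the subgroup reveals its coefficients. *)
Lemma doubled_sum_leaf p n : doubled_sum p (e n.+1) = a n *~ p`_n.
Proof.
have pN : (size p <= maxn (size p) n.+1)%N by exact: leq_maxl.
have nN : (n < maxn (size p) n.+1)%N by exact: leq_maxr.
rewrite (doubled_sum_widen _ _ pN) fct_sumE (bigD1 (Ordinal nN))//= big1 ?addr0.
  by rewrite mulrz_fctE /doubled asboolT//; right.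
move=> m mn; rewrite mulrz_fctE /doubled asboolF ?mul0rz//.
by case=> /e_inj // -[nm]; case/eqP: mn; exact: val_inj.
Qed.

Lemma doubled_sum_supp p : direct_sum [set: I] (doubled_sum p).
Proof.
apply: (subgroup_sum (subgroup_direct_sum _ _ _)) => n _.
apply: (subgroupMz (subgroup_direct_sum _ _ _)); split; last by move=> i; case.
apply: (@sub_finite_set _ _ [set e 0; e n.+1]).
  by move=> i /=; rewrite /doubled; case: asboolP.
exact: finite_set2.
Qed.

Lemma countable_range_doubled_sum : countable (range doubled_sum).
Proof. by apply: sub_countable (card_image_le _ _) _; exact: countableP. Qed.

Lemma controllable_range_doubled_sum : controllable (range doubled_sum).
Proof.
move=> J _; congr projection; apply/esym/setIidPl => _ [p _ <-].
exact: doubled_sum_supp.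
Qed.

(** Since [K] is finite, the indices [e n.+1] in [K] have [n < N] for some [N].
    The value [a N] at [e 0] is then out of reach of elements supported in [K],
    whose terms [a n *~ p`_n] with [n >= N] are all zero. *)
Lemma not_uniformly_controllable_range_doubled_sum :
  (forall n, ~ subgroup_generated [set a m | m in `I_n] (a n)) ->
  ~ uniformly_controllable (range doubled_sum).
Proof.
move=> a_esc /(_ [set e 0] (finite_set1 _))[K fK projK].
have [N Nmax] : exists N, forall n, K (e n.+1) -> (n < N)%N.
  have /finite_seqP[s sK] : finite_set [set n | K (e n.+1)].
    by apply: (finite_preimage (f := fun n => e n.+1)) fK => m n _ _ /e_inj[].
  exists (\max_(n <- s) n.+1) => n Kn.
  have ns : n \in s by have : [set n | K (e n.+1)] n by []; rewrite sK.
  exact: (@leq_bigmax_seq _ _ predT (fun n => n.+1)).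
have : projection [set e 0] (range doubled_sum) (sigL _ (doubled_sum 'X^N)).
  by exists (doubled_sum 'X^N) => //; exists 'X^N.
rewrite projK => -[_ [[p _ <-] [_ p0]]] /eq_sigLP /(_ (e 0)).
rewrite inE => /(_ erefl); rewrite !doubled_sum_root => rootE.
have aN : \sum_(n < size ('X^N : {poly int})) a n *~ 'X^N`_n = a N.
  rewrite size_polyXn (bigD1 ord_max)//= coefXn eqxx big1 ?addr0// => n nN.
  by rewrite coefXn (negbTE (nN : val n != N)).
apply: (a_esc N); rewrite -[X in _ X]aN -rootE.
have sG := @subgroup_subgroup_generated _ [set a m | m in `I_N].
apply: (subgroup_sum sG) => n _.
have [nN|Nn] := ltnP n N.
  by apply: (subgroupMz sG); apply: sub_gen_smallest; exists (n : nat).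
rewrite -doubled_sum_leaf p0; first exact: (subgroup0 sG).
by move=> /Nmax; rewrite ltnNge Nn.
Qed.

End Counterexample.

Theorem theorem3p1 (M : zmodType) (I : Type) :
  [<-> forall H : set (I -> M), subgroup H -> countable H ->
         controllable H -> uniformly_controllable H;
       forall H : set (I -> M), subgroup H ->
         controllable H -> uniformly_controllable H;
       finite_set [set: I] \/ finitely_generated M].
Proof.
have sufficiency : finite_set [set: I] \/ finitely_generated M ->
    forall H : set (I -> M), subgroup H ->
    controllable H -> uniformly_controllable H.
  move=> [fI H _ cH J fJ|]; first by exists [set: I] => //; exact: cH.
  exact: finitely_generated_uniformly_controllable.
have necessity : (forall H : set (I -> M), subgroup H -> countable H ->
         controllable H -> uniformly_controllable H) ->
    finite_set [set: I] \/ finitely_generated M.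
  move=> unif; apply: contrapT => /not_orP[].
  move=> /(infinite_setT_injection I)[e e_inj] /(escaping_sequence M)[a a_esc].
  have := not_uniformly_controllable_range_doubled_sum _ _ a e e_inj a_esc.
  apply; apply: unif.
  - apply: subgroup_image; first exact: doubled_sumB.
    by apply/subgroupP.
  - exact: countable_range_doubled_sum.
  - exact: controllable_range_doubled_sum.
tfae=> [/necessity/sufficiency//|unif|/sufficiency unif H sH _]; last exact: unif.
by apply: necessity => H sH _; exact: unif.
Qed.
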